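(* Let $B$ be a compact $k$-fold abelian bundle, with factors $B_0,B_1,\dots,B_k=B$ and structure groups $Z_1,\dots,Z_k$. Then there is a unique regular Borel probability measure $\mu$ on $B$ with the following property: for each $i\in\{1,\dots,k\}$, letting $\pi_i$ be the projection $B\to B_i$, the Borel probability measure $\mu\circ\pi_i^{-1}$ on $B_i$ is invariant under the action of $Z_i$.
   Context: ''Compact space'' means compact Hausdorff second-countable topological space. An abelian bundle $B$ with base $S$, structure group $Z$ (an abelian group) and projection $\pi:B\to S$ is a set $B$ with a free action $\alpha:Z\times B\to B$, written $(z,b)\mapsto b+z$, such that $s\mapsto\pi^{-1}(s)$ is a bijection from $S$ to the set of $Z$-orbits. It is a compact abelian bundle if $B,S$ are compact spaces, $Z$ is a compact (second-countable Hausdorff) abelian topological group, $\alpha$ is continuous, and a set $U\subset S$ is open if and only if $\pi^{-1}(U)$ is open in $B$. A compact $k$-fold abelian bundle with factors $B_0,\dots,B_k=B$ and structure groups $Z_1,\dots,Z_k$ consists of a one-point space $B_0$ and, for each $i\in\{1,\dots,k\}$, a compact abelian bundle $B_i$ with base $B_{i-1}$, structure group $Z_i$ and projection $B_i\to B_{i-1}$. The projection $\pi_i:B\to B_i$ is the composition of the projections $B_k\to B_{k-1}\to\cdots\to B_i$. *)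

(* Defs.v *)
From HB Require Import structures.
From mathcomp Require Import all_boot all_order all_algebra.
From mathcomp Require Import all_classical all_reals all_analysis.

Set Implicit Arguments.
Unset Strict Implicit.
Unset Printing Implicit Defensive.

Import Order.TTheory GRing.Theory Num.Theory.

Local Open Scope classical_set_scope.
Local Open Scope ring_scope.

Definition compact_space (T : topologicalType) : Prop :=
  [/\ compact [set: T], hausdorff_space T & @second_countable T].

(* [act z b] is the translate usually written [b + z]. *)
Definition orbit_of (Z B : Type) (act : Z -> B -> B) (b : B) : set B :=
  range (act^~ b).

Record is_abelian_bundle (Z : zmodType) (S B : Type)
    (act : Z -> B -> B) (pi : B -> S) : Prop := {
  bundle_act0 : forall b, act 0 b = b ;
  bundle_actD : forall z1 z2 b, act (z1 + z2) b = act z2 (act z1 b) ;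
  bundle_free : forall z b, act z b = b -> z = 0 ;
  bundle_fibres :
    set_bij [set: S] (range (orbit_of act)) (fun s => pi @^-1` [set s])
}.

Record is_compact_abelian_bundle (Z : topologicalZmodType)
    (S B : topologicalType) (act : Z -> B -> B) (pi : B -> S) : Prop := {
  bundle_abelian : is_abelian_bundle act pi ;
  bundle_total_compact : compact_space B ;
  bundle_base_compact : compact_space S ;
  bundle_group_compact : compact_space Z ;
  bundle_act_continuous : continuous (fun zb : Z * B => act zb.1 zb.2) ;
  bundle_openE : forall U : set S, open U <-> open (pi @^-1` U)
}.

(* Only the indices [0 <= i <= k] of [kfold_factor] and [1 <= i <= k] of
   [kfold_group] and [kfold_act] matter; the values elsewhere are
   unconstrained, and any finite tower extends to such families.  The factors
   are pointed because the library's measurable types are; this loses nothing,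
   as every factor of a tower over a one-point space is nonempty.
   [kfold_group i] acts on [kfold_factor i], whose base is [kfold_factor i.-1]. *)
Record kfold_abelian_bundle (k : nat) := {
  kfold_factor : nat -> ptopologicalType ;
  kfold_group : nat -> topologicalZmodType ;
  kfold_act : forall i, kfold_group i -> kfold_factor i -> kfold_factor i ;
  kfold_proj : forall i, kfold_factor i.+1 -> kfold_factor i ;
  kfold_factor0 : [set: kfold_factor 0%N] = [set point] ;
  kfold_bundle : forall i, (i < k)%N ->
    is_compact_abelian_bundle (@kfold_act i.+1) (@kfold_proj i)
}.

Arguments kfold_factor {k} _ _.
Arguments kfold_group {k} _ _.
Arguments kfold_act {k} _ {i} _ _.
Arguments kfold_proj {k} _ _ _.

Fixpoint iter_proj (T : nat -> Type) (p : forall i, T i.+1 -> T i) (i n : nat) :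
    T (n + i)%N -> T i :=
  if n is m.+1 then fun b => iter_proj p (p (m + i)%N b) else id.

Definition kfold_proj_to (k : nat) (B : kfold_abelian_bundle k) (i : nat)
    (leik : (i <= k)%N) (b : kfold_factor B k) : kfold_factor B i :=
  iter_proj (T := kfold_factor B) (kfold_proj B)
    (ecast m (kfold_factor B m) (esym (subnK leik)) b).

Notation borel T := (g_sigma_algebraType (@open T)).

Definition regular_measure (R : realType) (T : ptopologicalType)
    (mu : {measure set (borel T) -> \bar R}) : Prop :=
  forall A : set (borel T), measurable A ->
    mu A = ereal_inf [set mu U | U in [set U : set T | open U /\ A `<=` U]] /\
    mu A = ereal_sup [set mu K | K in [set K : set T | compact K /\ K `<=` A]].

Definition invariant_under (R : realType) (Z : Type) (T : ptopologicalType)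
    (act : Z -> T -> T) (mu : set (borel T) -> \bar R) : Prop :=
  forall (z : Z) (A : set (borel T)), measurable A ->
    mu (act z @^-1` A) = mu A.

Definition factorwise_invariant (R : realType) (k : nat)
    (B : kfold_abelian_bundle k)
    (mu : {measure set (borel (kfold_factor B k)) -> \bar R}) : Prop :=
  forall (i : nat) (leik : (i <= k)%N), (0 < i)%N ->
    invariant_under (@kfold_act k B i)
      (pushforward (T2 := borel (kfold_factor B i)) mu (kfold_proj_to leik)).

(* Main.v *)
(* A mean on a compact space X is a normalised positive linear functional on
   C(X).  If Z acts on a compact bundle B over S, the finite averages of the
   translates of f in C(B) can be made arbitrarily close to being constant on
   the orbits: average over long progressions in the directions of a finite net
   of Z, using that Z is commutative.  Hence f has a unique Z-invariant average,
   a continuous function on S, to which finite averages of translates of f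
   converge uniformly; this replaces Haar integration over Z.  Composing means
   on S with averaging gives exactly the Z-invariant means on B, so going up the
   tower yields a unique factorwise invariant mean on C(B_k), and the Riesz
   representation theorem turns it into the required measure. *)

Require Import Defs.
From HB Require Import structures.
From mathcomp Require Import all_boot all_order all_algebra lra.
From mathcomp Require Import all_classical all_reals all_analysis.
From mathcomp Require Import measurable_realfun.

Set Implicit Arguments.
Unset Strict Implicit.
Unset Printing Implicit Defensive.

Import Order.TTheory GRing.Theory Num.Theory.
Import numFieldNormedType.Exports.

Local Open Scope classical_set_scope.
Local Open Scope ring_scope.

(** * Continuous functions on compact spaces *)

(** Finitely many of the given neighbourhoods cover [K], and by monotonicity the largest of their
    indices serves everywhere. This packages every extraction of a finite subcover indexed by
    [nat]. *)
Lemma compact_monotone_cover (X : topologicalType) (K : set X)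
    (P : nat -> X -> Prop) :
  compact K -> (forall n m x, (n <= m)%N -> P n x -> P m x) ->
  (forall x, K x -> exists n, \forall y \near x, P n y) ->
  exists n, forall x, K x -> P n x.
Proof.
move=> /compact_near_coveringP cK mono loc.
have : eventually (fun n => K `<=` P n).
  apply: (cK nat eventually P) => x /loc[n Pn].
  exists ([set y | P n y], [set m | (n <= m)%N]) => /=; last first.
    by move=> -[y m] /= [Pny nm]; exact: mono Pny.
  by split => //; exists n.
by move=> [n _ Hn]; exists n; exact: (Hn n (leqnn n)).
Qed.

Section continuity.
Context (R : realType) (X : topologicalType).
Implicit Types f g : X -> R.

Lemma continuous_add f g :
  continuous f -> continuous g -> continuous (fun x => f x + g x).
Proof. by move=> cf cg x; apply: cvgD; [exact: cf|exact: cg]. Qed.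

Lemma continuous_scale c f : continuous f -> continuous (fun x => c * f x).
Proof. by move=> cf x; apply: cvgM; [exact: cvg_cst|exact: cf]. Qed.

Lemma continuous_const (c : R) : continuous (fun _ : X => c).
Proof. by move=> x; exact: cvg_cst. Qed.

Lemma continuous_sub f g :
  continuous f -> continuous g -> continuous (fun x => f x - g x).
Proof. by move=> cf cg x; apply: cvgB; [exact: cf|exact: cg]. Qed.

Lemma continuous_sum (I : Type) (s : seq I) (f : I -> X -> R) :
  (forall i, continuous (f i)) -> continuous (fun x => \sum_(i <- s) f i x).
Proof.
move=> cf; elim: s => [|i s IH].
  by under eq_fun do rewrite big_nil; exact: continuous_const.
by under eq_fun do rewrite big_cons; exact: continuous_add.
Qed.

Lemma continuous_minr f g :
  continuous f -> continuous g -> continuous (fun x => Num.min (f x) (g x)).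
Proof. by move=> cf cg; apply: min_fun_continuous. Qed.

Lemma continuous_maxr f g :
  continuous f -> continuous g -> continuous (fun x => Num.max (f x) (g x)).
Proof. by move=> cf cg; apply: max_fun_continuous. Qed.

Lemma open_superlevel f c : continuous f -> open [set x | c < f x].
Proof.
move=> cf; apply: (@open_comp _ _ f [set y | c < y]); first by move=> x _; exact: cf.
exact: open_gt.
Qed.

Lemma continuous_bounded f : compact [set: X] -> continuous f ->
  exists2 M, 0 <= M & forall x, `|f x| <= M.
Proof.
move=> cX cf.
have [| |n Hn] := @compact_monotone_cover _ _ (fun n x => `|f x| < n%:R) cX.
- by move=> n m x nm /lt_le_trans; apply; rewrite ler_nat.
- move=> x _; exists (Num.truncn `|f x|).+1.
  apply: open_nbhs_nbhs; split; last exact: truncnS_gt.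
  have cn : continuous (fun x => `|f x|) by move=> y; apply: cvg_norm; exact: cf.
  apply: (@open_comp _ _ (fun x => `|f x|) [set y | y < _]); last exact: open_lt.
  by move=> y _; exact: cn.
- by exists n%:R => // x; apply/ltW/Hn.
Qed.

End continuity.

(** * Continuous approximations of indicators of open sets *)

Section bumps.
Context (R : realType) (X : topologicalType).
Hypothesis cX : compact_space X.

Lemma countable_basis_seq : exists b : nat -> set X,
  forall x V, nbhs x V -> exists n, [/\ open (b n), b n x & b n `<=` V].
Proof.
have [_ _ [B /pfcard_geP[B0|[b]] [Bo Bx]]] := cX.
  (* An empty base forces the space to be empty, so any sequence serves. *)
  exists (fun=> set0) => x V /Bx[U [/=]]; by rewrite B0.
exists b => x V /Bx[U [/= BU Ux] UV].
have [n _ nU] := @surj _ _ _ _ b _ BU.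
by exists n; rewrite nU; split => //; exact: Bo.
Qed.

(** For each basic set whose closure lies in [U], Urysohn's lemma gives a function equal to 1 on it
    and 0 off [U]; by regularity such sets cover [U]. Partial sums truncated at 1 increase, and at
    each point of [U] they reach 1 after finitely many terms, which is what compactness arguments
    can use. *)
Lemma open_indicator_approx (U : set X) : open U ->
  exists h : nat -> X -> R,
    [/\ forall n, continuous (h n),
        forall n x, 0 <= h n x <= 1,
        forall n x, ~ U x -> h n x = 0,
        forall n m x, (n <= m)%N -> h n x <= h m x &
        forall x, U x -> exists n, h n x = 1].
Proof.
move=> oU; have [b bP] := countable_basis_seq; have [kX hX _] := cX.
have nX := compact_normal hX kX.
have /choice[g gP] n : exists g : X -> R, [/\ continuous g,
    forall x, 0 <= g x <= 1, forall x, ~ U x -> g x = 0 &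
    closure (b n) `<=` U -> forall x, b n x -> g x = 1].
  have [bU|bU] := pselect (closure (b n) `<=` U); last first.
    exists (fun=> 0); split => //; first exact: continuous_const.
    by move=> ?; rewrite lexx ler01.
  have := @normal_uniform_separator _ nX (~` U) (closure (b n)).
  move=> /(_ (open_closedC oU) (@closed_closure _ _)).
  have dUb : ~` U `&` closure (b n) = set0.
    by rewrite setIC; apply/disjoints_subset; rewrite setCK.
  move=> /(_ dUb) /(@uniform_separatorP _ R)[g [cg g01 g0 g1]].
  exists g; split => //.
  - by move=> x; have := g01 (g x); rewrite /= in_itv/=; apply; exists x.
  - by move=> x Ux; apply: g0; exists x.
  - by move=> _ x bx; apply: g1; exists x => //; exact: subset_closure.
have g0 i x : 0 <= g i x by have [_ /(_ x)/andP[]] := gP i.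
pose S n x := \sum_(0 <= i < n) g i x.
have S0 n x : 0 <= S n x by apply: sumr_ge0.
have Smono n m x : (n <= m)%N -> S n x <= S m x.
  by move=> nm; rewrite /S (big_cat_nat _ nm)//= lerDl sumr_ge0.
exists (fun n x => Num.min 1 (S n x)); split.
- move=> n; apply: continuous_minr; first exact: continuous_const.
  by apply: continuous_sum => i; have [] := gP i.
- by move=> n x; rewrite le_min ler01 S0/= ge_min lexx.
- move=> n x Ux; rewrite /S big1 ?min_r// => i _.
  by have [_ _ ->] := gP i.
- move=> n m x nm; rewrite le_min ge_min lexx/= ge_min; apply/orP; right.
  exact: Smono.
- move=> x Ux.
  have xU : nbhs x U by apply: open_nbhs_nbhs.
  have [V xV clVU] := compact_regular hX kX filterT xU.
  have [n [on bnx bnV]] := bP x V xV.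
  exists n.+1; apply: min_l; rewrite /S big_nat_recr//=.
  have [_ _ _ ->] := gP n => //; first by rewrite lerDr sumr_ge0.
  by apply: subset_trans clVU; exact: closureS.
Qed.

End bumps.

(** * Means and integration *)

(* Only the values of [L] at continuous functions are constrained. *)
Record is_mean (R : realType) (X : topologicalType) (L : (X -> R) -> R) : Prop := {
  meanD : forall f g : X -> R, continuous f -> continuous g ->
    L (fun x => f x + g x) = L f + L g ;
  meanZ : forall c (f : X -> R), continuous f -> L (fun x => c * f x) = c * L f ;
  mean_ge0 : forall f : X -> R, continuous f -> (forall x, 0 <= f x) -> 0 <= L f ;
  mean1 : L (fun=> 1) = 1
}.

Section mean_theory.
Context (R : realType) (X : topologicalType) (L : (X -> R) -> R).
Hypothesis mL : is_mean L.
Implicit Types f g : X -> R.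

Lemma mean_const c : L (fun=> c) = c.
Proof.
have := meanZ mL c (@continuous_const R X 1); rewrite (mean1 mL) mulr1 => Lc.
by rewrite -[RHS]Lc; congr L; apply/funext => x; rewrite mulr1.
Qed.

Lemma meanB f g : continuous f -> continuous g ->
  L (fun x => f x - g x) = L f - L g.
Proof.
move=> cf cg.
have := meanD mL cf (continuous_scale (c := -1) cg).
rewrite (meanZ mL)// mulN1r => <-; congr L.
by apply/funext => x; rewrite mulN1r.
Qed.

Lemma mean_le f g : continuous f -> continuous g ->
  (forall x, f x <= g x) -> L f <= L g.
Proof.
move=> cf cg fg; rewrite -subr_ge0 -meanB//; apply: (mean_ge0 mL).
  exact: continuous_sub.
by move=> x; rewrite subr_ge0.
Qed.

(** A mean preserves order and fixes constants, hence is 1-Lipschitz for the uniform norm. *)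
Lemma mean_dist f g e : continuous f -> continuous g ->
  (forall x, `|f x - g x| <= e) -> `|L f - L g| <= e.
Proof.
move=> cf cg fg; rewrite -meanB// ler_norml.
have cfg := continuous_sub cf cg.
rewrite -{1}(mean_const (- e)) -{2}(mean_const e).
by apply/andP; split; apply: mean_le => //; try exact: continuous_const;
  move=> x; have := fg x; rewrite ler_norml => /andP[].
Qed.

Lemma mean_sum (I : Type) (s : seq I) (f : I -> X -> R) :
  (forall i, continuous (f i)) ->
  L (fun x => \sum_(i <- s) f i x) = \sum_(i <- s) L (f i).
Proof.
move=> cf; elim: s => [|i s IH].
  by under eq_fun do rewrite big_nil; rewrite big_nil mean_const.
under eq_fun do rewrite big_cons.
by rewrite (meanD mL)// ?IH ?big_cons//; exact: continuous_sum.
Qed.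

End mean_theory.

(** * Borel probability measures as means *)

Section integration.
Context (R : realType) (X : ptopologicalType).
Implicit Types mu nu : probability (borel X) R.

Lemma open_measurable_borel (U : set X) : open U -> measurable (U : set (borel X)).
Proof. by move=> oU; apply: sub_sigma_algebra. Qed.

Lemma continuous_measurable_borel (f : X -> R) : continuous f ->
  measurable_fun [set: borel X] (f : borel X -> R).
Proof.
move=> cf; apply: (measurability _ (RGenOInfty.measurableE R)).
move=> _ [_ [a ->]] <-; rewrite setTI.
apply: open_measurable_borel.
rewrite [X in open X](_ : _ = [set x | a < f x]); first exact: open_superlevel.
by apply/seteqP; split => x; rewrite /= in_itv/= andbT.
Qed.

Lemma continuous_integrable mu (f : X -> R) : compact [set: X] -> continuous f ->
  mu.-integrable [set: borel X] (EFin \o (f : borel X -> R)).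
Proof.
move=> kX cf; apply: measurable_bounded_integrable => //.
- by rewrite [X in (X < _)%E]probability_setT ltry.
- exact: continuous_measurable_borel.
- have [M M0 fM] := continuous_bounded kX cf.
  exists M; split; first exact: num_real.
  by move=> K MK x _; apply: le_trans (fM x) (ltW MK).
Qed.

Definition expect mu (f : X -> R) : R := \int[mu]_(x in [set: borel X]) f x.

Lemma expect_mean mu : compact [set: X] -> is_mean (expect mu).
Proof.
move=> kX; have int f := @continuous_integrable mu f kX.
split.
- by move=> f g cf cg; apply: RintegralD => //; exact: int.
- by move=> c f cf; apply: RintegralZl => //; exact: int.
- by move=> f _ f0; exact: Rintegral_ge0.
- by rewrite /expect Rintegral_cst// [X in fine X]probability_setT mul1r.
Qed.

Lemma expect_indic_le mu (f : X -> R) (A : set (borel X)) :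
  compact [set: X] -> continuous f -> measurable A ->
  (forall x, 0 <= f x) -> (forall x, A x -> 1 <= f x) ->
  fine (mu A) <= expect mu f.
Proof.
move=> kX cf mA f0 f1.
have -> : fine (mu A) = \int[mu]_(x in [set: borel X]) (\1_A x : R).
  by rewrite /Rintegral integral_indic// setIT.
apply: le_Rintegral => //.
- apply: measurable_bounded_integrable => //.
  + by rewrite [X in (X < _)%E]probability_setT ltry.
  + exists 1; split; first exact: num_real.
    move=> K K1 x _; rewrite /= indicE ger0_norm ?ler0n//.
    by apply: le_trans (ltW K1); rewrite lern1 leq_b1.
- exact: continuous_integrable.
- move=> x _; rewrite indicE; case: (boolP (x \in A)) => [/set_mem/f1//|_].
  exact: f0.
Qed.

(** This is the previous bound for [1 - f] and the complement of [A]. *)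
Lemma expect_le_indic mu (f : X -> R) (A : set (borel X)) :
  compact [set: X] -> continuous f -> measurable A ->
  (forall x, f x <= 1) -> (forall x, ~ A x -> f x <= 0) ->
  expect mu f <= fine (mu A).
Proof.
move=> kX cf mA f1 f0.
have := @expect_indic_le mu (fun x => 1 - f x) (~` A) kX.
rewrite (meanB (expect_mean mu kX))//; last exact: continuous_const.
rewrite (mean1 (expect_mean mu kX)) probability_setC//.
have -> : fine (1 - mu A)%E = 1 - fine (mu A).
  by rewrite fineB// fin_num_measure.
have cst1 := @continuous_const R X 1.
move=> /(_ (continuous_sub cst1 cf) (measurableC mA)) H.
suff : 1 - fine (mu A) <= 1 - expect mu f by rewrite lerD2l lerN2.
by apply: H => x; [rewrite subr_ge0|move=> /f0; rewrite lerDl oppr_ge0].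
Qed.

(** Open sets are stable under intersection and generate the Borel sets, so agreement on them
    suffices. An open set is exhausted by superlevel sets of its approximations, which continuous
    functions separate from its complement. *)
Lemma expect_unique mu nu : compact_space X ->
  (forall f, continuous f -> expect mu f = expect nu f) ->
  forall A : set (borel X), measurable A -> mu A = nu A.
Proof.
move=> cX munu; have [kX _ _] := cX.
suff le_open (m1 m2 : probability (borel X) R) (U : set X) :
    (forall f, continuous f -> expect m1 f = expect m2 f) -> open U ->
    (m1 U <= m2 U)%E.
  have eq_open (U : set X) : open U -> mu U = nu U.
    move=> oU; apply/eqP; rewrite eq_le !le_open// => f cf.
    by rewrite munu.
  move=> A mA; apply: (@measure_unique _ R (borel X) (@open X) (fun=> setT)) => //.
  - exact: openI.
  - by move=> _; exact: openT.
  - by rewrite bigcup_const//; exists 0%N.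
  - by move=> _; rewrite [X in (X < _)%E]probability_setT ltry.
move=> m12 oU; have [h [ch h01 h0 hmono h1]] := open_indicator_approx R cX oU.
(* Any threshold strictly between 0 and 1 would exhaust [U]. With 1/2, [Num.min 1 (2 * h n x)]
   equals 1 on [V n] and vanishes off [U], so its integral lies between [m1 (V n)] and [m2 U]. *)
pose V n : set (borel X) := [set x | 2^-1 < h n x].
have oV n : open (V n) by exact: open_superlevel.
have UV : U = \bigcup_n V n.
  apply/seteqP; split => [x /h1[n hn]|x [n _]].
    by exists n => //; rewrite /V/= hn; lra.
  rewrite /V/= => Vx; apply: contrapT => /(h0 n) hx; move: Vx.
  by rewrite hx; lra.
have mV n : measurable (V n) by exact: open_measurable_borel.
have := @nondecreasing_cvg_mu _ _ _ m1 V mV.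
rewrite -UV => /(_ (open_measurable_borel oU)) cvgV.
suff m1V n : (m1 (V n) <= m2 U)%E.
  have ndV : {homo V : n m / (n <= m)%N >-> (n <= m)%O}.
    move=> n m nm; apply/subsetPset => x; rewrite /V/= => /lt_le_trans; apply.
    exact: hmono.
  have /cvg_lim <- := cvgV ndV; last by [].
  apply: lime_le; first by apply/cvg_ex; exists (m1 U); exact: cvgV.
  by near=> n; exact: m1V.
have cmin : continuous (fun x => Num.min 1 (2 * h n x)).
  by apply: continuous_minr; [exact: continuous_const|exact: continuous_scale].
have fm (m : probability (borel X) R) (A : set (borel X)) : measurable A ->
    m A = (fine (m A))%:E.
  by move=> mA; rewrite fineK// fin_num_measure.
rewrite fm// [leRHS]fm ?lee_fin; last exact: open_measurable_borel.
apply: (@le_trans _ _ (expect m1 (fun x => Num.min 1 (2 * h n x)))).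
  apply: expect_indic_le => // x; rewrite le_min ?lexx ?ler01/=.
    by have /andP[] := h01 n x; lra.
  by rewrite /V/=; lra.
rewrite m12//; apply: expect_le_indic => //.
- exact: open_measurable_borel.
- by move=> x; rewrite ge_min lexx.
- by move=> x /(h0 n) ->; rewrite mulr0 ge_min lexx orbT.
Unshelve. all: by end_near.
Qed.
End integration.

(** * Averages along the orbits of an abelian bundle *)

Section averages.
Context (R : realType) (Z : topologicalZmodType) (S B : topologicalType).
Context (act : Z -> B -> B) (pi : B -> S).
Hypothesis bundleB : is_compact_abelian_bundle act pi.
Implicit Types (e : R) (f : B -> R) (g : S -> R) (s t : seq Z).

Let abelianB := bundle_abelian bundleB.

Lemma bundle_act_comm z w b : act z (act w b) = act w (act z b).
Proof. by rewrite -!(bundle_actD abelianB) addrC. Qed.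

Lemma bundle_proj_act z b : pi (act z b) = pi b.
Proof.
have [+ _ _] := bundle_fibres abelianB.
move=> /(_ (pi b) I)[b0 _ fibb0].
have : (pi @^-1` [set pi b]) b by [].
rewrite -fibb0 => -[w _ wb].
have : orbit_of act b0 (act z b).
  by exists (w + z) => //; rewrite (bundle_actD abelianB) wb.
by rewrite fibb0.
Qed.

Lemma bundle_proj_orbit b b' : pi b = pi b' -> exists z, b' = act z b.
Proof.
have [+ _ _] := bundle_fibres abelianB.
move=> /(_ (pi b) I)[b0 _ fibb0] bb'.
have : (pi @^-1` [set pi b]) b by [].
have : (pi @^-1` [set pi b]) b' by [].
rewrite -fibb0 => -[w' _ <-] [w _ <-]; exists (w' - w).
by rewrite -(bundle_actD abelianB) addrC subrK.
Qed.

Lemma bundle_proj_surj x : exists b, pi b = x.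
Proof.
have [+ _ _] := bundle_fibres abelianB.
move=> /(_ x I)[b _ fibb]; exists b.
have : orbit_of act b b by exists 0 => //; exact: (bundle_act0 abelianB).
by rewrite fibb.
Qed.

Lemma bundle_proj_continuous : continuous pi.
Proof. by apply/continuousP => U /(bundle_openE bundleB). Qed.

Lemma bundle_translate_continuous z : continuous (act z).
Proof.
move=> b; apply: (@continuous_comp _ _ _ (pair z) (fun zb => act zb.1 zb.2)).
  by apply: cvg_pair => //; exact: cvg_cst.
exact: (bundle_act_continuous bundleB).
Qed.

Lemma continuous_translate f z : continuous f -> continuous (f \o act z).
Proof.
move=> cf b; apply: continuous_comp; last exact: cf.
exact: bundle_translate_continuous.
Qed.

(** A list keeps multiplicities, so that averages compose exactly under sums of lists. The empty
    list gives 0, whence the assumptions [s != [::]] below. *)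
Definition avg s f (b : B) : R := (size s)%:R^-1 * \sum_(z <- s) f (act z b).

Lemma avg_continuous s f : continuous f -> continuous (avg s f).
Proof.
move=> cf; apply: continuous_scale; apply: continuous_sum => z.
exact: continuous_translate.
Qed.

Lemma avgD s f f' b :
  avg s (fun b => f b + f' b) b = avg s f b + avg s f' b.
Proof. by rewrite /avg big_split mulrDr. Qed.

Lemma avgZ s c f b : avg s (fun b => c * f b) b = c * avg s f b.
Proof. by rewrite /avg -mulr_sumr mulrCA. Qed.

Lemma avg_comm s t f b : avg s (avg t f) b = avg t (avg s f) b.
Proof.
rewrite /avg -!mulr_sumr mulrCA exchange_big/=.
do 2![congr (_ * _)]; apply: eq_bigr => w _; apply: eq_bigr => z _.
by rewrite bundle_act_comm.
Qed.

Lemma avg_comp s t f b : avg [seq z + w | z <- s, w <- t] f b = avg s (avg t f) b.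
Proof.
rewrite /avg size_allpairs natrM invfM big_allpairs_dep/= -mulrA; congr (_ * _).
rewrite mulr_sumr; apply: eq_bigr => z _; congr (_ * _); apply: eq_bigr => w _.
by rewrite (bundle_actD abelianB).
Qed.

Lemma avg_translate s f z b : avg s f (act z b) = avg s (f \o act z) b.
Proof.
rewrite /avg; congr (_ * _); apply: eq_bigr => w _ /=.
by rewrite bundle_act_comm.
Qed.

Lemma avg_dist s (f f' : B -> R) e b : s != [::] ->
  (forall z, `|f (act z b) - f' (act z b)| <= e) ->
  `|avg s f b - avg s f' b| <= e.
Proof.
case: s => // z0 s _ ff'; rewrite /avg -mulrBr -sumrB normrM.
rewrite ger0_norm ?invr_ge0// mulrC ler_pdivrMr ?ltr0n//.
apply: le_trans (ler_norm_sum _ _ _) _.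
apply: (@le_trans _ _ (\sum_(z <- z0 :: s) e)); first exact: ler_sum.
by rewrite big_const_seq count_predT iter_addr_0 mulr_natr.
Qed.

Lemma avg_invariant s f b : s != [::] -> (forall z, f (act z b) = f b) ->
  avg s f b = f b.
Proof.
case: s => // z0 s _ fb; rewrite /avg; under eq_bigr do rewrite fb.
rewrite big_const_seq count_predT iter_addr_0 -[f b *+ _]mulr_natr mulrC mulfK//.
by rewrite pnatr_eq0.
Qed.

Lemma avg_near s f b e : s != [::] ->
  (forall z, `|f (act z b) - f b| <= e) -> `|avg s f b - f b| <= e.
Proof.
move=> s0 fe; rewrite -[X in _ - X](@avg_invariant s (fun=> f b) b)//.
exact: avg_dist.
Qed.

(** As [B] is compact, [z] maps continuously to the translate [f \o act z] in the uniform norm; as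
    [Z] is compact, the set of translates is totally bounded. *)
Lemma translate_net f e : continuous f -> 0 < e ->
  exists t, forall z, exists2 w, w \in t &
    forall b, `|f (act z b) - f (act w b)| <= e.
Proof.
move=> cf e0.
have near_translate w : \forall z \near w,
    forall b, `|f (act z b) - f (act w b)| <= e.
  have [/compact_near_coveringP kB _ _] := bundle_total_compact bundleB.
  have := kB Z (nbhs w) (fun z b => `|f (act z b) - f (act w b)| <= e)
    (nbhs_filter w).
  suff loc (b : B) : \forall b' \near b & z \near w,
      `|f (act z b') - f (act w b')| <= e.
    move=> /(_ (fun b _ => loc b)); apply: filterS => z Hz b; exact: Hz b I.
  have e20 : 0 < e / 2 by rewrite divr_gt0.
  have near_w : \forall b' \near b, `|f (act w b) - f (act w b')| < e / 2.
    have /cvgrPdist_lt := @continuous_translate f w cf b; exact.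
  have cfact : continuous (fun zb : Z * B => f (act zb.1 zb.2)).
    move=> zb; apply: (@continuous_comp _ _ _ (fun zb => act zb.1 zb.2) f).
      exact: (bundle_act_continuous bundleB).
    exact: cf.
  have /cvgrPdist_lt/(_ _ e20)[[P Q] /= [wP bQ] PQ] := cfact (w, b).
  exists (Q `&` [set b' | `|f (act w b) - f (act w b')| < e / 2], P) => /=.
    by split => //; exact: filterI.
  move=> [b' z] [[/= Qb' wb'] Pz].
  have := PQ (z, b') (conj Pz Qb') => /= zb'.
  rewrite -(subrK (f (act w b)) (f (act z b'))) -addrA.
  apply: le_trans (ler_normD _ _) _; rewrite (splitr e) distrC.
  by rewrite lerD// ltW.
have [/compact_near_coveringP kZ _ _] := bundle_group_compact bundleB.
(* Filter of the sections of the finite subsets of [Z] ordered by inclusion. *)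
pose F := [set A : set (seq Z) | exists t0, forall t, {subset t0 <= t} -> A t].
have FF : Filter F.
  split.
  - by exists [::].
  - move=> P Q [t1 t1P] [t2 t2Q]; exists (t1 ++ t2) => t t12; split.
      by apply: t1P => z zt; apply: t12; rewrite mem_cat zt.
    by apply: t2Q => z zt; apply: t12; rewrite mem_cat zt orbT.
  - by move=> P Q PQ [t0 t0P]; exists t0 => t /t0P/PQ.
have := kZ (seq Z) F (fun t z => exists2 w, w \in t &
    forall b, `|f (act z b) - f (act w b)| <= e) FF.
case.
  move=> w _; exists ([set z | forall b, `|f (act z b) - f (act w b)| <= e],
    [set t | w \in t]) => /=.
    split; first exact: near_translate.
    by exists [:: w] => t; apply; rewrite mem_head.
  by move=> -[z t] /= [zw wt]; exists w.
by move=> t0 Ht0; exists t0 => z; exact: Ht0.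
Qed.

(** Translation by [z] shifts the progression by one step, so the difference of the sums telescopes
    to two end terms. *)
Lemma cesaro_osc (f : B -> R) (M : R) z n b : (forall b, `|f b| <= M) ->
  `|avg [seq z *+ i | i <- iota 0 n.+1] f (act z b) -
    avg [seq z *+ i | i <- iota 0 n.+1] f b| <= 2 * M / n.+1%:R.
Proof.
move=> fM; rewrite /avg size_map size_iota !big_map -mulrBr -sumrB.
pose u i := f (act (z *+ i) b).
have -> : \sum_(i <- iota 0 n.+1)
    (f (act (z *+ i) (act z b)) - f (act (z *+ i) b)) = u n.+1 - u 0%N.
  rewrite -(telescope_sumr u (leq0n n.+1)) /index_iota subn0.
  by apply: eq_bigr => i _; rewrite -(bundle_actD abelianB) -mulrS.
rewrite mulrC normrM [X in _ * X]ger0_norm ?invr_ge0//.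
rewrite ler_pM2r ?invr_gt0//; apply: le_trans (ler_normB _ _) _.
by rewrite mulr_natl mulr2n; apply: lerD; exact: fM.
Qed.

Lemma net_osc (f : B -> R) (M : R) t e : (forall b, `|f b| <= M) -> 0 < e ->
  exists2 s, s != [::] &
    forall w, w \in t -> forall b, `|avg s f (act w b) - avg s f b| <= e.
Proof.
move=> fM e0; elim: t => [|w t [s s0 sP]]; first by exists [:: 0].
(* Translations commute, so averaging further along multiples of [w] keeps the
   bounds already obtained for [t]. *)
pose n := Num.truncn (2 * M / e).
pose c := [seq w *+ i | i <- iota 0 n.+1].
exists [seq z + z' | z <- s, z' <- c].
  by rewrite -size_eq0 size_allpairs size_map size_iota muln_eq0 size_eq0 negb_or s0.
move=> w' + b; rewrite !avg_comp inE => /predU1P[->|w't].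
  rewrite avg_translate; apply: avg_dist => // z /=.
  apply: le_trans (cesaro_osc w n (act z b) fM) _.
  (* The choice of [n] ensures [2 * M / e < n.+1]. *)
  by rewrite ler_pdivrMr// -ler_pdivrMl// mulrC; apply/ltW/truncnS_gt.
rewrite avg_comm [X in _ - X]avg_comm avg_translate; apply: avg_dist => // z /=.
exact: sP.
Qed.

(** Half of [e] pays for replacing [z] by a nearby element of the net, the other half for the
    oscillation along the net. *)
Lemma small_osc f e : continuous f -> 0 < e ->
  exists2 s, s != [::] & forall z b, `|avg s f (act z b) - avg s f b| <= e.
Proof.
move=> cf e0; have e20 : 0 < e / 2 by rewrite divr_gt0.
have [kB _ _] := bundle_total_compact bundleB.
have [M M0 fM] := continuous_bounded kB cf.
have [t tP] := translate_net cf e20.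
have [s s0 sP] := net_osc t fM e20.
exists s => // z b; have [w wt zw] := tP z.
rewrite -(subrK (avg s f (act w b)) (avg s f (act z b))) -addrA.
apply: le_trans (ler_normD _ _) _; rewrite (splitr e) lerD//; last exact: sP.
rewrite !avg_translate; apply: avg_dist => // z' /=.
exact: zw.
Qed.

(** The function [g] plays the role of the Haar integral of [f] over orbits. One list [s] must serve
    all orbits at once, so that means, being Lipschitz, respect the approximation. *)
Definition is_average f g := continuous g /\
  forall e, 0 < e -> exists2 s, s != [::] & forall b, `|avg s f b - g (pi b)| <= e.

(** Two averages that are nearly constant on orbits nearly agree: each is close to the iterated
    average, which does not depend on the order. Their common value is invariant and is a uniform
    limit of continuous functions, so it descends to a continuous function on [S]. *)
Lemma average_exists f : continuous f -> exists g, is_average f g.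
Proof.
move=> cf.
pose good s e := [/\ s != [::], 0 < e &
  forall z b, `|avg s f (act z b) - avg s f b| <= e].
have good_le s e t e' b : good s e -> good t e' ->
    avg s f b - e <= avg t f b + e'.
  move=> [s0 e0 sP] [t0 e'0 tP].
  have := @avg_near t (avg s f) b e t0 (sP^~ b).
  have := @avg_near s (avg t f) b e' s0 (tP^~ b).
  by rewrite avg_comm !ler_norml => /andP[? ?] /andP[? ?]; lra.
have good_ex e : 0 < e -> exists s, good s e.
  by move=> e0; have [s s0 sP] := small_osc cf e0; exists s.
(* [h] separates the lower bounds [avg s f b - e] from the upper bounds
   [avg s f b + e], so no limit of averages has to be taken. *)
pose E b := [set y | exists s e, good s e /\ y = avg s f b - e].
pose h b := sup (E b).
have hP s e b : good s e -> `|avg s f b - h b| <= e.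
  move=> gse.
  have ubE : ubound (E b) (avg s f b + e).
    by move=> _ [t [e' [gte' ->]]]; exact: good_le.
  have Ese : E b (avg s f b - e) by exists s, e.
  have h1 : avg s f b - e <= h b.
    by apply: ub_le_sup Ese; exists (avg s f b + e).
  have h2 : h b <= avg s f b + e by apply: ge_sup => //; exists (avg s f b - e).
  by rewrite ler_norml; apply/andP; split; lra.
have h_inv z b : h (act z b) = h b.
  apply/eqP; rewrite -subr_eq0 -normr_le0; apply/ler_addgt0Pl => e e0.
  have e30 : 0 < e / 3 by rewrite divr_gt0.
  have [s gs] := good_ex _ e30.
  have := hP _ _ b gs; have := hP _ _ (act z b) gs.
  have [_ _ /(_ z b)] := gs.
  rewrite addr0 !ler_norml => /andP[? ?] /andP[? ?] /andP[? ?].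
  by apply/andP; split; lra.
have ch : continuous h.
  move=> b; apply/cvgrPdist_lt => e e0.
  have e30 : 0 < e / 3 by rewrite divr_gt0.
  have [s gs] := good_ex _ e30.
  have /cvgrPdist_lt/(_ _ e30) := @avg_continuous s f cf b.
  apply: filterS => b'; have := hP _ _ b gs; have := hP _ _ b' gs.
  rewrite !ler_norml !ltr_norml => /andP[? ?] /andP[? ?] /andP[? ?].
  by apply/andP; split; lra.
(* The section [sec] may be discontinuous. Invariance of [h] gives [h \o sec \o pi = h], and
   continuity of [h \o sec] then comes from the quotient topology on [S]. *)
have [sec secP] := choice bundle_proj_surj.
have g_pi b : h (sec (pi b)) = h b.
  by have [z ->] := bundle_proj_orbit (esym (secP (pi b))); rewrite h_inv.
exists (h \o sec); split.
  apply/continuousP => U oU; apply/(bundle_openE bundleB).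
  rewrite [X in open X](_ : _ = h @^-1` U); first by move/continuousP: ch; apply.
  by apply/seteqP; split => b; rewrite /= g_pi.
move=> e e0; have [s gs] := good_ex _ e0; have [s0 _ _] := gs.
by exists s => // b; rewrite /= g_pi; exact: hP.
Qed.

(** The iterated average over both lists is close to [g \o pi] in one order and to [g' \o pi] in the
    other, and the two orders agree. *)
Lemma average_unique f g g' : is_average f g -> is_average f g' -> g = g'.
Proof.
move=> [_ gP] [_ g'P]; apply/funext => x; have [b <-] := bundle_proj_surj x.
apply/eqP; rewrite -subr_eq0 -normr_le0; apply/ler_addgt0Pl => e e0.
have e20 : 0 < e / 2 by rewrite divr_gt0.
have [s s0 sP] := gP _ e20; have [t t0 tP] := g'P _ e20.
have pi_inv (k : S -> R) u : u != [::] -> avg u (k \o pi) b = k (pi b).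
  by move=> u0; rewrite avg_invariant// => z; rewrite /= bundle_proj_act.
have := @avg_dist t (avg s f) (g \o pi) _ b t0 (fun z => sP (act z b)).
have := @avg_dist s (avg t f) (g' \o pi) _ b s0 (fun z => tP (act z b)).
rewrite !pi_inv// avg_comm addr0 !ler_norml => /andP[? ?] /andP[? ?].
by apply/andP; split; lra.
Qed.

(** The two functions come with different lists. Averaging further preserves a bound already
    obtained, so the list of all sums suits both. *)
Lemma average_add f f' g g' : is_average f g -> is_average f' g' ->
  is_average (fun b => f b + f' b) (fun x => g x + g' x).
Proof.
move=> [cg gP] [cg' g'P]; split; first exact: continuous_add.
move=> e e0; have e20 : 0 < e / 2 by rewrite divr_gt0.
have [s s0 sP] := gP _ e20; have [t t0 tP] := g'P _ e20.
exists [seq z + z' | z <- s, z' <- t].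
  by rewrite -size_eq0 size_allpairs muln_eq0 !size_eq0 negb_or s0.
move=> b; have pi_inv (k : S -> R) u : u != [::] -> avg u (k \o pi) b = k (pi b).
  by move=> u0; rewrite avg_invariant// => z; rewrite /= bundle_proj_act.
have := @avg_dist t (avg s f) (g \o pi) _ b t0 (fun z => sP (act z b)).
have := @avg_dist s (avg t f') (g' \o pi) _ b s0 (fun z => tP (act z b)).
have -> : avg [seq z + z' | z <- s, z' <- t] (fun b => f b + f' b) b =
    avg t (avg s f) b + avg s (avg t f') b.
  by rewrite avgD !avg_comp avg_comm.
rewrite !pi_inv// !ler_norml => /andP[? ?] /andP[? ?].
by apply/andP; split; lra.
Qed.

Lemma average_scale c f g : is_average f g ->
  is_average (fun b => c * f b) (fun x => c * g x).
Proof.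
move=> [cg gP]; split; first exact: continuous_scale.
(* Adding 1 covers the case [c = 0]. *)
move=> e e0; have c10 : 0 < `|c| + 1 by rewrite ltr_pwDr.
have [s s0 sP] := gP _ (divr_gt0 e0 c10); exists s => // b.
rewrite avgZ -mulrBr normrM.
apply: (@le_trans _ _ ((`|c| + 1) * (e / (`|c| + 1)))).
  by apply: ler_pM => //; rewrite lerDl.
by rewrite mulrC divfK// gt_eqF.
Qed.

Lemma average_ge0 f g : is_average f g -> (forall b, 0 <= f b) -> forall x, 0 <= g x.
Proof.
move=> [_ gP] f0 x; have [b <-] := bundle_proj_surj x.
apply/ler_addgt0Pl => e e0; have [s s0 sP] := gP _ e0.
have : 0 <= avg s f b by rewrite mulr_ge0 ?invr_ge0// sumr_ge0.
by have := sP b; rewrite ler_norml => /andP[? ?]; lra.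
Qed.

Lemma average_pullback g : continuous g -> is_average (g \o pi) g.
Proof.
move=> cg; split => // e e0; exists [:: 0] => // b.
rewrite avg_invariant//; first by rewrite subrr normr0 ltW.
by move=> z; rewrite /= bundle_proj_act.
Qed.

Lemma average_translate f g z : is_average f g -> is_average (f \o act z) g.
Proof.
move=> [cg gP]; split => // e e0; have [s s0 sP] := gP _ e0; exists s => // b.
by rewrite -avg_translate -(bundle_proj_act z); exact: sP.
Qed.

(** The default 0 is taken only when [f] has no average, hence never for continuous [f]. *)
Definition average f : S -> R := xget (fun=> 0) [set g | is_average f g].

Lemma averageP f : continuous f -> is_average f (average f).
Proof. by move=> /average_exists[g fg]; apply: xgetPex; exists g. Qed.

Lemma averageE f g : is_average f g -> average f = g.
Proof. by move=> fg; apply: average_unique (fg); apply: xgetPex; exists g. Qed.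

Lemma average_continuous f : continuous f -> continuous (average f).
Proof. by move=> /averageP[]. Qed.

Lemma average_mean (L : (S -> R) -> R) : is_mean L -> is_mean (L \o average).
Proof.
move=> mL; split => /=.
- move=> f f' cf cf'; rewrite (averageE (average_add (averageP cf) (averageP cf'))).
  by apply: (meanD mL); exact: average_continuous.
- move=> c f cf; rewrite (averageE (average_scale c (averageP cf))).
  by apply: (meanZ mL); exact: average_continuous.
- move=> f cf f0; apply: (mean_ge0 mL); first exact: average_continuous.
  exact: average_ge0 (averageP cf) f0.
- rewrite (averageE (average_pullback (@continuous_const R S 1))).
  exact: mean1 mL.
Qed.

(** An invariant mean gives [avg s f] the same value as [f], while [avg s f] is uniformly close to
    [average f \o pi]. So [M] is determined by its values on functions pulled back from [S]. *)
Lemma invariant_mean_average (M : (B -> R) -> R) f : is_mean M ->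
  (forall f z, continuous f -> M (f \o act z) = M f) ->
  continuous f -> M f = M (average f \o pi).
Proof.
move=> mM Minv cf; have [cg gP] := averageP cf.
apply/eqP; rewrite -subr_eq0 -normr_le0; apply/ler_addgt0Pl => e e0.
rewrite addr0; have [s s0 sP] := gP _ e0.
have <- : M (avg s f) = M f.
  rewrite (meanZ mM); last first.
    by apply: continuous_sum => z; exact: continuous_translate.
  rewrite (mean_sum mM); last by move=> z; exact: continuous_translate.
  under eq_bigr do rewrite (Minv f)//.
  rewrite big_const_seq count_predT iter_addr_0 -[M f *+ _]mulr_natl mulKf//.
  by rewrite pnatr_eq0 size_eq0.
apply: (mean_dist mM) => //; first exact: avg_continuous.
by move=> b; apply: continuous_comp; [exact: bundle_proj_continuous|exact: cg].
Qed.

End averages.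

(** * The Riesz representation theorem *)

Section riesz.
Context (R : realType) (X : ptopologicalType) (L : (X -> R) -> R).
Hypotheses (cX : compact_space X) (mL : is_mean L).
Implicit Types (f g : X -> R) (U V W A : set X).

Let kX : compact [set: X]. Proof. by have [] := cX. Qed.

(** Vanishing off [U] replaces the customary condition of compact support inside [U]. *)
Definition subordinate U f : Prop :=
  [/\ continuous f, forall x, 0 <= f x <= 1 & forall x, ~ U x -> f x = 0].

Definition open_content U : R := sup [set L f | f in subordinate U].

Lemma subordinate0 U : subordinate U (fun=> 0).
Proof. by split=> //; [exact: continuous_const|move=> x; rewrite lexx ler01]. Qed.

Lemma subordinate_mean U f : subordinate U f -> 0 <= L f <= 1.
Proof.
move=> [cf f01 _]; rewrite (mean_ge0 mL)//=; last by move=> x; have /andP[] := f01 x.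
rewrite -[leRHS](mean1 mL); apply: mean_le => //; first exact: continuous_const.
by move=> x; have /andP[] := f01 x.
Qed.

Lemma open_content_ge U f : subordinate U f -> L f <= open_content U.
Proof.
move=> Uf; apply: ub_le_sup; last by exists f.
by exists 1 => _ [g /subordinate_mean/andP[_ ?] <-].
Qed.

Lemma open_content_le U c :
  (forall f, subordinate U f -> L f <= c) -> open_content U <= c.
Proof.
move=> Uc; apply: ge_sup; last by move=> _ [f Uf <-]; exact: Uc.
by exists (L (fun=> 0)), (fun=> 0) => //; exact: subordinate0.
Qed.

Lemma open_content_adherent U (e : R) : 0 < e ->
  exists2 f, subordinate U f & open_content U - e < L f.
Proof.
move=> e0.
have [|_ [f Uf <-] Hf] :=
    @sup_adherent _ [set L f | f in subordinate U] e e0.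
  split; first by exists (L (fun=> 0)), (fun=> 0) => //; exact: subordinate0.
  by exists 1 => _ [g /subordinate_mean/andP[_ ?] <-].
by exists f.
Qed.

Lemma open_content_ge0 U : 0 <= open_content U.
Proof. by rewrite -(mean_const mL 0); apply/open_content_ge/subordinate0. Qed.

Lemma open_content_le1 U : open_content U <= 1.
Proof. by apply: open_content_le => f /subordinate_mean/andP[]. Qed.

Lemma open_content_mono U V : U `<=` V -> open_content U <= open_content V.
Proof.
move=> UV; apply: open_content_le => f [cf f01 f0]; apply: open_content_ge.
by split => // x Vx; apply: f0 => /UV.
Qed.

Lemma open_content_setT : open_content setT = 1.
Proof.
apply/eqP; rewrite eq_le open_content_le1 -{1}(mean1 mL); apply: open_content_ge.
by split=> [|x|x /(_ I)//]; [exact: continuous_const|rewrite lexx ler01].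
Qed.

Lemma open_content_set0 : open_content set0 = 0.
Proof.
apply/eqP; rewrite eq_le open_content_ge0 andbT.
apply: open_content_le => f [_ _ f0].
by rewrite (_ : f = fun=> 0) ?(mean_const mL)//; apply/funext => x; exact: f0.
Qed.

(** A nearly optimal [f] for the union is dominated, up to [e / 2], by a finite sum of functions
    subordinate to the [U i]: points of the union are handled by the approximations, the others by
    [f = 0], and compactness makes the choice uniform. *)
Lemma open_content_bigcup (U : nat -> set X) : (forall i, open (U i)) ->
  ((open_content (\bigcup_i U i))%:E <= \sum_(i <oo) (open_content (U i))%:E)%E.
Proof.
move=> oU; have /choice[h hP] i := open_indicator_approx R cX (oU i).
have h0 i n x : 0 <= h i n x by have [_ /(_ n x)/andP[]] := hP i.
have ch i n : continuous (h i n) by have [] := hP i.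
have w0 i : (0 <= (open_content (U i))%:E)%E by rewrite lee_fin open_content_ge0.
apply/lee_addgt0Pr => e e0.
have e20 : 0 < e / 2 by rewrite divr_gt0.
have [f [cf f01 f0] wf] := open_content_adherent (\bigcup_i U i) e20.
have ch_sum n : continuous (fun x => \sum_(i < n) h i n x).
  by apply: continuous_sum => i; exact: ch.
(* The same [n] bounds the number of sets and the stage of approximation, so the condition is
   monotone in one index. *)
have [| |n fn] := @compact_monotone_cover X setT
    (fun n x => 0 < \sum_(i < n) h i n x + (e / 2 - f x)) kX.
- move=> n m x nm /lt_le_trans; apply; rewrite lerD2r.
  rewrite -(big_mkord xpredT (fun i => h i n x)).
  rewrite -(big_mkord xpredT (fun i => h i m x)) (big_cat_nat _ nm)//=.
  rewrite -[leLHS]addr0; apply: lerD; last exact: sumr_ge0.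
  by apply: ler_sum => i _; have [_ _ _ + _] := hP i; apply.
- move=> x _; have [N N0] : exists n, 0 < \sum_(i < n) h i n x + (e / 2 - f x).
    have [[i _ Ux]|Ux] := pselect ((\bigcup_i U i) x); last first.
      by exists 0%N; rewrite f0// big_ord0 subr0 add0r.
    have [_ _ _ hmono /(_ x Ux)[k hk]] := hP i.
    (* The index must exceed [i] for the [i]-th term to occur, and be at least [k] for that term to
       reach 1, which is at least [f x]. *)
    exists (maxn i.+1 k); have im : (i < maxn i.+1 k)%N by rewrite leq_maxl.
    rewrite (bigD1 (Ordinal im))//=.
    have : h i k x <= h i (maxn i.+1 k) x by apply: hmono; exact: leq_maxr.
    have /andP[_] := f01 x.
    have : 0 <= \sum_(j < maxn i.+1 k | j != Ordinal im) h j (maxn i.+1 k) x.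
      exact: sumr_ge0.
    by rewrite hk; lra.
  exists N; apply: open_nbhs_nbhs; split => //.
  apply: (open_superlevel (f := fun x => _ + (_ - _))).
  apply: continuous_add => //; apply: continuous_sub => //; exact: continuous_const.
have Lf : L f <= \sum_(i < n) open_content (U i) + e / 2.
  apply: (@le_trans _ _ (L (fun x => \sum_(i < n) h i n x + e / 2))).
    apply: mean_le => // [|x]; last by have := fn x I; lra.
    by apply: continuous_add => //; exact: continuous_const.
  rewrite (meanD mL)//; last exact: continuous_const.
  rewrite (mean_const mL) lerD2r (mean_sum mL)//.
  apply: ler_sum => i _; apply: open_content_ge.
  by have [? h01 h00 _ _] := hP i; split=> [//|x|x]; [exact: h01|exact: h00].
apply: (@le_trans _ _ ((\sum_(i < n) open_content (U i))%:E + e%:E)%E).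
  by rewrite -EFinD lee_fin; lra.
rewrite leeD2r//; apply: le_trans (nneseries_lim_ge n _); last first.
  by move=> k _ _; exact: w0.
by rewrite big_mkord -sumEFin.
Qed.

(** * The outer measure of a mean and its restriction to Borel sets *)

Definition outer_content A : R :=
  inf [set open_content U | U in [set U | open U /\ A `<=` U]].

Lemma outer_content_le A U : open U -> A `<=` U -> outer_content A <= open_content U.
Proof.
move=> oU AU; apply: ge_inf; last by exists U.
by exists 0 => _ [V _ <-]; exact: open_content_ge0.
Qed.

Lemma outer_content_ge A c :
  (forall U, open U -> A `<=` U -> c <= open_content U) -> c <= outer_content A.
Proof.
move=> Ac; apply: lb_le_inf; last by move=> _ [U [oU AU] <-]; exact: Ac.
by exists (open_content setT), setT => //; split => //; exact: openT.
Qed.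

Lemma outer_content_adherent A (e : R) : 0 < e ->
  exists U, [/\ open U, A `<=` U & open_content U < outer_content A + e].
Proof.
move=> e0.
have [|_ [U [oU AU] <-] HU] :=
    @inf_adherent _ [set open_content U | U in [set U | open U /\ A `<=` U]] e e0.
  split; last by exists 0 => _ [V _ <-]; exact: open_content_ge0.
  by exists (open_content setT), setT => //; split => //; exact: openT.
by exists U.
Qed.

Lemma outer_content_open U : open U -> outer_content U = open_content U.
Proof.
move=> oU; apply/eqP; rewrite eq_le outer_content_le//=.
by apply: outer_content_ge => V _; exact: open_content_mono.
Qed.

Definition riesz_outer A : \bar R := (outer_content A)%:E.

Lemma riesz_outer0 : riesz_outer set0 = 0%E.
Proof.
rewrite /riesz_outer outer_content_open ?open_content_set0//.
exact: open0.
Qed.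

Lemma riesz_outer_ge0 A : (0 <= riesz_outer A)%E.
Proof.
by rewrite lee_fin; apply: outer_content_ge => U _ _; exact: open_content_ge0.
Qed.

Lemma riesz_outer_mono : {homo riesz_outer : A B / A `<=` B >-> (A <= B)%E}.
Proof.
move=> A B AB; rewrite lee_fin; apply: outer_content_ge => U oU BU.
by apply: outer_content_le => //; exact: subset_trans BU.
Qed.

Lemma riesz_outer_sigma_subadditive : sigma_subadditive riesz_outer.
Proof.
move=> F; apply/lee_addgt0Pr => e e0.
have ei i : 0 < e / (2 ^ i.+1)%:R by rewrite divr_gt0// ltr0n expn_gt0.
have /choice[U UP] i := outer_content_adherent (F i) (ei i).
apply: le_trans
  (epsilon_trick xpredT (fun i => riesz_outer_ge0 (F i)) (ltW e0)).
apply: (@le_trans _ _ (open_content (\bigcup_i U i))%:E).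
  rewrite lee_fin; apply: outer_content_le.
    by apply: bigcup_open => i _; have [] := UP i.
  by apply: subset_bigcup => i _; have [] := UP i.
apply: le_trans (open_content_bigcup _) _; first by move=> i; have [] := UP i.
apply: lee_nneseries => [i _|i _]; first by rewrite lee_fin open_content_ge0.
by rewrite -EFinD lee_fin; have [_ _ /ltW] := UP i.
Qed.

Definition riesz_outer_measure : {outer_measure set X -> \bar R} :=
  HB.pack_for (outer_measure R X) riesz_outer
    (isOuterMeasure.Build R X riesz_outer riesz_outer0 riesz_outer_ge0
      riesz_outer_mono riesz_outer_sigma_subadditive).

(** Subadditivity leaves one inequality. Nearly optimal functions for [V]&[U] and for a
    neighbourhood [W] of the rest of [A] are added; [W] is chosen after [f], so that their sum
    barely exceeds 1. *)
Lemma riesz_open_caratheodory U :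
  open U -> riesz_outer_measure.-caratheodory U.
Proof.
move=> oU; apply: le_caratheodory_measurable => A /=.
rewrite -EFinD lee_fin; apply/ler_addgt0Pr => e e0.
(* Four errors of at most [d] occur: in the choices of [V], [f] and [g], and in the rescaling by
   [1 + d]. *)
have d0 : 0 < e / 4 by rewrite divr_gt0.
set d := e / 4 in d0 *.
have [V [oV AV Vd]] := outer_content_adherent A d0.
have [f VUf fd] := open_content_adherent (V `&` U) d0.
have [cf f01 f0] := VUf.
(* This is the part of [V] where [f < d]; it contains [A] minus [U] because [f] vanishes off [U]. *)
pose W := V `&` [set x | - d < - f x].
have oW : open W.
  apply: openI => //; apply: open_superlevel.
  by move=> x; apply: cvgN; exact: cf.
have [g [cg g01 g0] gd] := open_content_adherent W d0.
have mU : outer_content (A `&` U) <= open_content (V `&` U).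
  by apply: outer_content_le; [exact: openI|exact: setSI].
have mW : outer_content (A `&` ~` U) <= open_content W.
  apply: outer_content_le => // x [/AV Vx nUx]; split => //=.
  by rewrite f0 ?oppr0 ?oppr_lt0// => -[].
have c0 : 0 < 1 + d by rewrite addr_gt0.
(* [g] vanishes where [f >= d], so [f + g <= 1 + d]. *)
have : L (fun x => (1 + d)^-1 * (f x + g x)) <= open_content V.
  apply: open_content_ge; split.
  - by apply: continuous_scale; exact: continuous_add.
  - move=> x; have /andP[? fx1] := f01 x; have /andP[? gx1] := g01 x.
    rewrite mulr_ge0 ?invr_ge0 ?addr_ge0 ?ler01 ?(ltW d0)//=.
    rewrite mulrC ler_pdivrMr// mul1r.
    have [fd'|fd'] := ltP (f x) d; first lra.
    by rewrite g0 ?addr0; [lra|move=> [_ /=]; lra].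
  - move=> x Vx; rewrite f0; last by case.
    by rewrite g0 ?addr0 ?mulr0//; case.
rewrite (meanZ mL) ?(meanD mL)//; last exact: continuous_add.
rewrite mulrC ler_pdivrMr// mulrDr mulr1 => LV.
have : open_content V * d <= d by rewrite ler_piMl ?open_content_le1 ?ltW.
by move: Vd fd gd LV mU mW; rewrite /d; lra.
Qed.

Lemma riesz_borel_caratheodory (A : set (borel X)) :
  measurable A -> riesz_outer_measure.-caratheodory A.
Proof.
apply: smallest_sub; last exact: riesz_open_caratheodory.
split => [|B mB|F mF].
- exact: caratheodory_measurable_set0.
- by rewrite setTD; exact: caratheodory_measurable_setC.
- exact: caratheodory_measurable_bigcup.
Qed.

(** The outer measure is retyped so that the measure structure is attached to the Borel
    sigma-algebra. *)
Definition riesz_fun : set (borel X) -> \bar R := riesz_outer.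

Lemma riesz_sigma_additive : semi_sigma_additive riesz_fun.
Proof.
move=> F mF tF mUF.
apply: (@caratheodory_measure_sigma_additive _ _ riesz_outer_measure) => //.
  by move=> i; exact: riesz_borel_caratheodory.
exact: riesz_borel_caratheodory.
Qed.

Lemma riesz_setT : riesz_fun setT = 1%E.
Proof.
rewrite /riesz_fun /riesz_outer outer_content_open ?open_content_setT//.
exact: openT.
Qed.

Definition riesz_measure : {measure set (borel X) -> \bar R} :=
  HB.pack_for (measure (borel X) R) riesz_fun
    (isMeasure.Build _ _ _ riesz_fun riesz_outer0 riesz_outer_ge0
      riesz_sigma_additive).

Definition riesz_probability : probability (borel X) R :=
  HB.pack_for (probability (borel X) R) (Measure.sort riesz_measure)
    (Measure_isProbability.Build _ _ _ riesz_measure riesz_setT).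

Lemma riesz_probability_open U : open U ->
  riesz_probability U = (open_content U)%:E.
Proof. by move=> oU; rewrite -outer_content_open. Qed.


Lemma riesz_probabilityE (A : set (borel X)) :
  riesz_probability A = (outer_content A)%:E.
Proof. by []. Qed.

Lemma riesz_expect_lower f : continuous f -> (forall x, 0 <= f x <= 1) ->
  L f <= expect riesz_probability f.
Proof.
move=> cf f01; set E := expect riesz_probability.
have mE : is_mean E := expect_mean _ kX.
(* Layer cake: [N f] is the sum of its slices [cut j (N f)] between the heights
   [j] and [j + 1], and slice [j + 1] lives where slice [j] equals [1]. *)
pose cut (j : nat) (t : R) : R := Num.min 1 (Num.max 0 (t - j%:R)).
have cut_sum n t : 0 <= t -> \sum_(0 <= j < n) cut j t = Num.min n%:R t.
  move=> t0; elim: n => [|n IH]; first by rewrite big_nil min_l.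
  rewrite big_nat_recr//= IH /cut -natr1.
  by rewrite /Num.min /Num.max; case: ifPn; case: ifPn; case: ifPn; case: ifPn; lra.
have cut01 j t : 0 <= cut j t <= 1.
  by rewrite le_min ge_min lexx le_max lexx ler01.
apply/ler_addgt0Pr => e e0; pose N := (Num.truncn e^-1).+1.
have N0 : 0 < N%:R :> R by rewrite ltr0n.
have Ne : 1 <= e * N%:R.
  by rewrite -ler_pdivrMl// mulr1; apply/ltW/truncnS_gt.
pose F j x := cut j (N%:R * f x).
have cF j : continuous (F j).
  apply: continuous_minr; first exact: continuous_const.
  apply: continuous_maxr; first exact: continuous_const.
  apply: continuous_sub; last exact: continuous_const.
  exact: continuous_scale.
have meanF (M : (X -> R) -> R) : is_mean M ->
    N%:R * M f = \sum_(0 <= j < N) M (F j).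
  move=> mM; rewrite -(meanZ mM)// -(mean_sum mM)//; congr M; apply/funext => x.
  have /andP[fx0 fx1] := f01 x; rewrite cut_sum ?mulr_ge0//.
  by rewrite min_r// ler_piMr.
(* The measure of [U] separates the two: slice [j.+1] is subordinate to [U], and slice [j] equals 1
   on [U]. *)
have stepF j : L (F j.+1) <= E (F j).
  pose U : set X := [set x | j.+1%:R < N%:R * f x].
  have oU : open U by apply: open_superlevel; exact: continuous_scale.
  apply: (@le_trans _ _ (fine (riesz_probability U))).
    rewrite riesz_probability_open//; apply: open_content_ge; split => //.
      by move=> x; exact: cut01.
    move=> x /negP; rewrite /U/= -leNgt /F /cut => ?.
    by rewrite max_l ?subr_le0// min_r.
  apply: expect_indic_le => //; first exact: open_measurable_borel.
    by move=> x; have /andP[] := cut01 j (N%:R * f x).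
  move=> x; rewrite /U/= /F /cut -natr1 => ?.
  by rewrite le_min lexx le_max; apply/orP; right; lra.
have : N%:R * L f <= 1 + N%:R * E f.
  (* The shift by one slice leaves the first slice under [L], worth at most 1, and the last under
     [E], which is nonnegative. Division by [N] turns this 1 into at most [e]. *)
  rewrite !meanF// big_nat_recl//= big_nat_recr//=; apply: lerD.
    rewrite -(mean1 mL); apply: mean_le => //; first exact: continuous_const.
    by move=> x; have /andP[] := cut01 0%N (N%:R * f x).
  rewrite -[leLHS]addr0; apply: lerD; first by apply: ler_sum => j _.
  by apply: (mean_ge0 mE) => // x; have /andP[] := cut01 N.-1 (N%:R * f x).
move=> H; rewrite -(ler_pM2l N0) mulrDr; apply: le_trans H _.
by rewrite addrC lerD2l mulrC.
Qed.

Lemma riesz_expect f : continuous f -> expect riesz_probability f = L f.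
Proof.
move=> cf; set E := expect riesz_probability.
have mE : is_mean E := expect_mean _ kX.
suff LE g : continuous g -> L g <= E g.
  apply/eqP; rewrite eq_le LE// andbT.
  have := LE _ (continuous_scale (c := -1) cf).
  by rewrite (meanZ mL)// (meanZ mE)// !mulN1r lerN2.
move=> cg; have [M M0 gM] := continuous_bounded kX cg.
(* The values of [g + M] lie between 0 and [2 * M]; the extra 1 keeps the divisor positive when
   [M = 0]. *)
have c0 : 0 < (2 * M + 1)^-1 by rewrite invr_gt0; lra.
have cM := @continuous_const R X M.
have cgM := continuous_add cg cM.
have := @riesz_expect_lower (fun x => (2 * M + 1)^-1 * (g x + M)).
rewrite (meanZ mL)// (meanD mL)// (mean_const mL) -/E.
rewrite (meanZ mE)// (meanD mE)// (mean_const mE).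
rewrite ler_pM2l// lerD2r; apply; first exact: continuous_scale.
move=> x; have := gM x; rewrite ler_norml => /andP[? ?].
rewrite mulr_ge0 ?(ltW c0)//=; last lra.
by rewrite mulrC ler_pdivrMr ?mul1r; lra.
Qed.

(** Outer regularity is built into the infimum. Inner regularity is outer regularity of the
    complement, since closed sets are compact here. *)
Lemma riesz_regular : regular_measure riesz_probability.
Proof.
have outerC (A : set (borel X)) : measurable A ->
    outer_content (~` A) = 1 - outer_content A.
  move=> mA; have := probability_setC riesz_probability mA.
  by rewrite !riesz_probabilityE => -[].
have mo (U : set X) : open U -> measurable (U : set (borel X)).
  exact: open_measurable_borel.
move=> A mA; split; apply/eqP; rewrite eq_le; apply/andP; split.
- apply: le_ereal_inf_tmp => _ [U [oU AU] <-].
  apply: le_measure => //; rewrite inE//.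
  exact: mo.
- apply/lee_addgt0Pr => e e0; have [U [oU AU Ue]] := outer_content_adherent A e0.
  apply: ge_ereal_inf; exists (riesz_probability U); first by exists U.
  change ((outer_content U)%:E <= (outer_content A)%:E + e%:E)%E.
  by rewrite -EFinD lee_fin outer_content_open// ltW.
- apply/lee_addgt0Pr => e e0.
  have [U [oU AU Ue]] := outer_content_adherent (~` A) e0.
  rewrite -leeBlDr//.
  change ((outer_content A)%:E - e%:E <=
    ereal_sup [set riesz_probability K | K in [set K | compact K /\ K `<=` A]])%E.
  apply: le_ereal_sup_tmp.
  exists (riesz_probability (~` U)).
    exists (~` U) => //; split; last by rewrite -[A]setCK; exact: subsetC.
    by apply: (subclosed_compact (open_closedC oU) kX).
  change ((outer_content A)%:E - e%:E <= (outer_content (~` U))%:E)%E.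
  rewrite outerC; last exact: mo.
  rewrite -EFinB lee_fin (outer_content_open oU).
  by move: Ue; rewrite outerC//; lra.
- apply: ge_ereal_sup => _ [K [kK KA] <-]; apply: le_measure => //; rewrite inE//.
  rewrite -[K]setCK; apply: measurableC; apply: mo; apply: closed_openC.
  by apply: compact_closed => //; have [] := cX.
Qed.

End riesz.

(** * Towers of bundles *)

Lemma image_probability (R : realType) (X Y : ptopologicalType)
    (mu : probability (borel X) R) (p : X -> Y) :
  compact [set: X] -> continuous p ->
  exists nu : probability (borel Y) R,
    (forall A, nu A = mu (p @^-1` A)) /\
    forall g, continuous g -> expect nu g = expect mu (g \o p).
Proof.
move=> kX cp.
have mp : measurable_fun [set: borel X] (p : borel X -> borel Y).
  apply: (@measurability _ _ (borel X) (borel Y) _ _ (@open Y) erefl).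
  move=> _ [U oU <-]; rewrite setTI.
  by apply: open_measurable_borel; apply: open_comp => // x _; exact: cp.
pose pm : {mfun borel X >-> borel Y} :=
  HB.pack_for {mfun borel X >-> borel Y} (p : borel X -> borel Y)
    (isMeasurableFun.Build _ _ _ _ _ mp).
exists (distribution mu pm); split => // g cg.
rewrite /expect /Rintegral; congr fine.
rewrite integral_pushforward//.
- by apply/measurable_EFinP; exact: continuous_measurable_borel.
- rewrite preimage_setT; apply: (continuous_integrable mu (f := g \o p)) => //.
  by move=> x; apply: continuous_comp; [exact: cp|exact: cg].
Qed.

Lemma eq_expect (R : realType) (X : ptopologicalType)
    (mu nu : probability (borel X) R) f :
  (forall A, measurable A -> mu A = nu A) -> expect mu f = expect nu f.
Proof.
move=> munu; rewrite /expect /Rintegral; congr fine.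
by apply: eq_measure_integral => A mA _; exact: munu.
Qed.

(** Both sides say that [mu] equals its image under each translation, tested on Borel sets or on
    continuous functions; [expect_unique] passes from the latter to the former. *)
Lemma invariant_expect (R : realType) (Z : topologicalZmodType)
    (S B : ptopologicalType) (act : Z -> B -> B) (pi : B -> S)
    (mu : probability (borel B) R) :
  is_compact_abelian_bundle act pi ->
  invariant_under act mu <->
  forall f z, continuous f -> expect mu (f \o act z) = expect mu f.
Proof.
move=> bB; have cB := bundle_total_compact bB; have [kB _ _] := cB.
split => [inv f z cf|inv z A mA].
  have [nu [nuE expE]] :=
    image_probability mu kB (bundle_translate_continuous bB (z := z)).
  by rewrite -expE//; apply: eq_expect => A mA; rewrite nuE inv.
have [nu [nuE expE]] :=
  image_probability mu kB (bundle_translate_continuous bB (z := z)).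
rewrite -nuE; apply: expect_unique => // f cf.
by rewrite expE// inv.
Qed.

Lemma singleton_compact_space (X : ptopologicalType) :
  [set: X] = [set point] -> compact_space X.
Proof.
move=> X1; have eqX (x y : X) : x = y.
  have : [set: X] x by []. have : [set: X] y by [].
  by rewrite X1 => -> ->.
split; first by rewrite X1; exact: compact_set1.
  by move=> x y _; exact: eqX.
exists [set setT]; first exact: countable1.
split; first by move=> _ ->; exact: openT.
move=> x V Vx; exists setT; first by [].
by move=> y _; rewrite (eqX y x); exact: nbhs_singleton.
Qed.

(** * Composite projections and their casts *)

Section iterated_projections.
Context (T : nat -> Type) (p : forall i, T i.+1 -> T i).

(** This is [kfold_proj_to] with an arbitrary top level [n], as induction on the height requires;
    the two are convertible at level [k]. *)
Definition proj_to n i (lein : (i <= n)%N) (b : T n) : T i :=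
  iter_proj p (ecast m (T m) (esym (subnK lein)) b).

(** Equality proofs in [nat] are unique, so the cast may use any convenient decomposition of [n]. *)
Lemma proj_toE n i d (lein : (i <= n)%N) (nE : n = (d + i)%N) b :
  proj_to lein b = iter_proj p (ecast m (T m) nE b).
Proof.
rewrite /proj_to; move: (esym _); have -> : (n - i = d)%N by rewrite nE addnK.
by move=> e; rewrite (eq_irrelevance e nE).
Qed.

Lemma proj_to_id n (lenn : (n <= n)%N) b : proj_to lenn b = b.
Proof. by rewrite (proj_toE (d := 0) lenn (erefl n)). Qed.

Lemma proj_toS n i (lein : (i <= n)%N) (leiSn : (i <= n.+1)%N) b :
  proj_to leiSn b = proj_to lein (p b).
Proof.
have nE := esym (subnK lein).
rewrite (proj_toE lein nE) (proj_toE (d := (n - i).+1) leiSn (congr1 S nE)) /=.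
move: (n - i)%N nE => d nE; move: b; clear leiSn lein; by subst n.
Qed.

End iterated_projections.

(** * Invariance along the tower *)

Section tower.
Context (R : realType) (k : nat) (B : kfold_abelian_bundle k).

Lemma kfold_compact i : (i <= k)%N -> compact_space (kfold_factor B i).
Proof.
case: i => [_|i ik]; first exact/singleton_compact_space/kfold_factor0.
exact: bundle_total_compact (kfold_bundle B ik).
Qed.

(** The argument is a bare set function, so pushing it down one level requires no measure
    structure. *)
Fixpoint tower_invariant n : (set (borel (kfold_factor B n)) -> \bar R) -> Prop :=
  match n with
  | 0 => fun=> True
  | m.+1 => fun mu => invariant_under (@kfold_act k B m.+1) mu /\
      @tower_invariant m (fun A => mu (kfold_proj B m @^-1` A))
  end.

Lemma tower_invariantP n (mu : set (borel (kfold_factor B n)) -> \bar R) :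
  tower_invariant mu <-> forall i (lein : (i <= n)%N), (0 < i)%N ->
    invariant_under (@kfold_act k B i)
      (fun A => mu (proj_to (kfold_proj B) lein @^-1` A)).
Proof.
elim: n mu => [|n IH] mu; first by split => // _ [].
split => [[inv /IH towinv] i lein i0|inv].
  have := lein; rewrite leq_eqVlt ltnS => /predU1P[iE|lein'].
    subst i; rewrite [X in invariant_under _ X](_ : _ = mu)//.
    apply/funext => A; congr mu.
    by apply/seteqP; split => b; rewrite /= proj_to_id.
  rewrite [X in invariant_under _ X](_ : _ =
      fun A => mu (kfold_proj B n @^-1` (proj_to (kfold_proj B) lein' @^-1` A))).
    exact: towinv.
  apply/funext => A; congr mu.
  by apply/seteqP; split => b; rewrite /= (proj_toS _ lein').
split.
  have := inv n.+1 (leqnn _) isT.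
  rewrite [X in invariant_under _ X](_ : _ = mu)//.
  apply/funext => A; congr mu.
  by apply/seteqP; split => b; rewrite /= proj_to_id.
apply/IH => i lein i0; have := inv i (leqW lein) i0.
rewrite [X in invariant_under _ X](_ : _ =
    fun A => mu (kfold_proj B n @^-1` (proj_to (kfold_proj B) lein @^-1` A)))//.
apply/funext => A; congr mu.
by apply/seteqP; split => b; rewrite /= (proj_toS _ lein).
Qed.

(** The equivalence carries both halves of the theorem: a measure representing [L] is invariant, and
    an invariant measure must represent [L]. *)
Lemma tower_mean n : (n <= k)%N ->
  exists2 L : (kfold_factor B n -> R) -> R, is_mean L &
    forall mu : probability (borel (kfold_factor B n)) R,
      (forall f, continuous f -> expect mu f = L f) <-> tower_invariant mu.
Proof.
elim: n => [_|n IH ltnk].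
  exists (fun f => f point); first by split.
  move=> mu; split => // _ f _.
  have [k0 _ _] := kfold_compact (leq0n k).
  rewrite -[RHS](mean_const (expect_mean mu k0)); congr expect.
  apply/funext => x; have : [set: kfold_factor B 0%N] x by [].
  by rewrite kfold_factor0 => ->.
have [L mL LP] := IH (ltnW ltnk); have bB := kfold_bundle B ltnk.
have [kB _ _] := bundle_total_compact bB.
exists (L \o average (kfold_act B (i := n.+1)) (kfold_proj B n)).
  exact: average_mean.
move=> mu; have [nu [nuE expE]] :=
  image_probability mu kB (bundle_proj_continuous bB).
have -> : tower_invariant mu <->
    invariant_under (@kfold_act k B n.+1) mu /\ tower_invariant nu.
  rewrite /=; suff -> : (fun A => mu (kfold_proj B n @^-1` A)) = nu by [].
  by apply/funext => A; rewrite nuE.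
(* Forwards, a translate has the same average as the function, and a pullback has the original
   function as its average. Backwards, [mu] sees [f] only through [average f], on which [nu] is
   known by induction. *)
split => [muL|[/(invariant_expect _ bB) inv /LP nuL] f cf].
  split.
    apply/(invariant_expect _ bB) => f z cf; rewrite !muL//=.
      by rewrite (averageE bB (average_translate bB z (averageP bB cf))).
    exact: (continuous_translate bB).
  apply/LP => g cg; rewrite expE// muL/=.
    by rewrite (averageE bB (average_pullback bB cg)).
  move=> b; apply: continuous_comp; last exact: cg.
  exact: (bundle_proj_continuous bB).
rewrite (invariant_mean_average bB (expect_mean mu kB))// -expE ?nuL//;
  exact: (average_continuous bB).
Qed.

End tower.

Theorem proposition2p2p5 (R : realType) (k : nat) (B : kfold_abelian_bundle k) :
  exists mu : probability (borel (kfold_factor B k)) R,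
    (regular_measure mu /\ factorwise_invariant mu) /\
    forall nu : probability (borel (kfold_factor B k)) R,
      regular_measure nu -> factorwise_invariant nu ->
      forall A : set (borel (kfold_factor B k)), measurable A -> nu A = mu A.
Proof.
have [L mL LP] := tower_mean R B (leqnn k).
have cB := kfold_compact B (leqnn k).
exists (riesz_probability cB mL); split.
  split; first exact: riesz_regular.
  (* At level [k], [factorwise_invariant] is convertible to the right-hand side of
     [tower_invariantP]. *)
  apply/(tower_invariantP (riesz_probability cB mL))/LP => f.
  exact: riesz_expect.
move=> nu _ /(tower_invariantP nu)/LP nuL A mA.
by apply: expect_unique => // f cf; rewrite nuL// riesz_expect.
Qed.
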